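(* Let $\mu_1<\mu_2$, $\alpha_0,\beta_0>0$, and let $G$ be the distribution of $(x,y)$ on $\mathbb{R}\times\{-1,+1\}$ with $y$ uniform on $\{-1,+1\}$, $x\mid y=-1\sim\mathrm{N}(\mu_1,\alpha_0,\beta_0)$, $x\mid y=+1\sim\mathrm{N}(\mu_2,\alpha_0,\beta_0)$. For $\theta\in\mathbb{R}$ let $f_\theta(x)=\mathrm{sign}(x+\theta)$, $\mathcal{L}(f_\theta)=\Pr_{(x,y)\sim G}[f_\theta(x)\ne y]$, and $\theta^\star=-\frac{\mu_1+\mu_2}{2}$. Then: (i) there is a constant $C_1'>0$ depending only on $\mu_1,\mu_2,\alpha_0,\beta_0$ with $\mathcal{L}(f_\theta)-\mathcal{L}(f_{\theta^\star})\le C_1'|\theta-\theta^\star|$ for all $\theta$; (ii) $\epsilon_0:=\mathbb{E}_{(x,y)\sim G}|x-y+\theta^\star|-\mathbb{E}_{(x,y)\sim G}|x-f_{\theta^\star}(x)+\theta^\star|>0$; (iii) for $\rho\in[0,1]$, let $G'_\rho$ be the distribution of $(x,y')$ where $(x,y)\sim G$ and $y'=\rho f_{\theta^\star}(x)+(1-\rho)y$. Fix $\theta_0\in\mathbb{R}$, $\eta\in(0,1)$, let $(x_t,y'_t)_{t\ge0}$ be i.i.d. from $G'_\rho$, and set $\theta_{t+1}=\theta_t-\eta(\theta_t+x_t-y'_t)$. Then for every $t\in\mathbb{N}$, $$\mathbb{E}\big[\mathcal{L}(f_{\theta_t})\big]-\mathcal{L}(f_{\theta^\star})\le C_2(1-\eta)^t+\big(1-(1-\eta)^t\big)\big(C_3-C_4\rho\big),$$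 where $C_2=C_1'|\theta_0-\theta^\star|$, $C_3=C_1'\,\mathbb{E}_{(x,y)\sim G}|x-y+\theta^\star|$ and $C_4=C_1'\epsilon_0>0$. In particular the bound is strictly decreasing in $\rho$ whenever $t\ge1$.
   Context: $\mathrm{N}(\mu,\alpha,\beta)$ denotes the generalized Gaussian distribution on $\mathbb{R}$ with density $\frac{\beta}{2\alpha\Gamma(1/\beta)}e^{-(|x-\mu|/\alpha)^\beta}$. The expectation is over the random samples; $\theta_0$ is deterministic. The value of $\mathrm{sign}(0)$ is irrelevant (a null event). *)

(* Defs.v *)
From HB Require Import structures.
From mathcomp Require Import all_boot all_order all_algebra.
From mathcomp Require Import all_classical all_reals all_analysis.
Set Implicit Arguments. Unset Strict Implicit. Unset Printing Implicit Defensive.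
Import Order.TTheory GRing.Theory Num.Theory.
Import numFieldNormedType.Exports.
Local Open Scope classical_set_scope.
Local Open Scope ring_scope.

Definition Rint {R : realType} (f : R -> R) : R :=
  Rintegral (@lebesgue_measure R) setT f.

Definition Gamma {R : realType} (s : R) : R :=
  Rintegral (@lebesgue_measure R) `]0, +oo[%classic
    (fun t => t `^ (s - 1) * expR (- t)).

Definition gg_pdf {R : realType} (mu alpha beta : R) (x : R) : R :=
  beta / (2 * alpha * Gamma (beta^-1)) * expR (- ((`|x - mu| / alpha) `^ beta)).

Definition fsign {R : realType} (theta x : R) : R := Num.sg (x + theta).

(* Expectation of h(x,y) for (x,y) ~ G: y uniform on {-1,+1},
   x | y=-1 ~ N(mu1,alpha0,beta0), x | y=+1 ~ N(mu2,alpha0,beta0). *)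
Definition EG {R : realType} (mu1 mu2 alpha0 beta0 : R) (h : R -> R -> R) : R :=
  2^-1 * Rint (fun x => h x (-1) * gg_pdf mu1 alpha0 beta0 x)
  + 2^-1 * Rint (fun x => h x 1 * gg_pdf mu2 alpha0 beta0 x).

Definition theta_star {R : realType} (mu1 mu2 : R) : R := - ((mu1 + mu2) / 2).

Definition loss {R : realType} (mu1 mu2 alpha0 beta0 theta : R) : R :=
  EG mu1 mu2 alpha0 beta0 (fun x y => (fsign theta x != y)%:R).

Definition EGp {R : realType} (mu1 mu2 alpha0 beta0 rho : R) (h : R -> R -> R) : R :=
  EG mu1 mu2 alpha0 beta0
    (fun x y => h x (rho * fsign (theta_star mu1 mu2) x + (1 - rho) * y)).

(* exp_loss t theta0 = E[ L(f_{theta_t}) ] where theta_{s+1} = theta_s - eta (theta_s + x_s - y'_s)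
   and (x_s,y'_s) i.i.d. ~ G'_rho: the expectation w.r.t. the product law of
   (x_0,y'_0),...,(x_{t-1},y'_{t-1}), written as the iterated (Fubini) integral
   over the first sample, then the second, etc. *)
Fixpoint exp_loss {R : realType} (mu1 mu2 alpha0 beta0 rho eta : R) (t : nat) (theta0 : R) : R :=
  match t with
  | 0%N => loss mu1 mu2 alpha0 beta0 theta0
  | t'.+1 => EGp mu1 mu2 alpha0 beta0 rho
      (fun x y' => exp_loss mu1 mu2 alpha0 beta0 rho eta t' (theta0 - eta * (theta0 + x - y')))
  end.

(* Main.v *)
Require Import Defs.
From HB Require Import structures.
From mathcomp Require Import all_boot all_order all_algebra.
From mathcomp Require Import all_classical all_reals all_analysis.
From mathcomp Require Import measurable_realfun ring lra.
Import Order.TTheory GRing.Theory Num.Theory.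
Import numFieldNormedType.Exports.
Local Open Scope classical_set_scope.
Local Open Scope ring_scope.

(* The kernel exp(-|u|^beta) is dominated by a multiple of 1 / ((1 + |u|)(1 + u^2)),
   so functions of linear growth are integrable against the densities, and the
   substitution t = u^beta identifies Gamma(1/beta) and gives them total mass 1.

   (i) Moving the threshold from theta_star to theta only changes the
   classification of points in an interval of length |theta - theta_star|, and
   both densities are bounded by their peak value, which serves as C1'.
   (ii) With z = x + theta_star, |z - sign z| <= |z - y| for y = 1 and y = -1, strictly
   when y is not the sign of z.
   (iii) theta_1 - theta_star = (1 - eta)(theta_0 - theta_star) - eta (z - y'), and
   |z - y'| <= (1 - rho) |z - y| + rho |z - sign z| by convexity; averaging over
   the first sample gives the induction on t. *)

(** * Affine change of variables and the dominating weight *)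

Section affine_substitution.
Context {R : realType}.
Let mu := @lebesgue_measure R.

Lemma ge0_integralT_affine (m a : R) (G : R -> R) : 0 < a ->
  continuous G -> (forall x, 0 <= G x) ->
  (\int[mu]_x (G ((x - m) / a))%:E = a%:E * \int[mu]_x (G x)%:E)%E.
Proof.
move=> a0 cG G0; pose F (x : R) : R := (x - m) / a.
have dF (x : R) : is_derive x 1 F a^-1.
  rewrite /F; apply: is_derive_eq.
  by rewrite scaler0 add0r subr0 /GRing.scale/= mulr1.
have F'E : (F^`())%classic = cst a^-1.
  by apply/funext => x; rewrite derive1E; exact: (@derive_val _ _ _ _ _ _ _ (dF x)).
have mGF : measurable_fun setT (fun x : R => G ((x - m) / a)).
  apply/measurableT_comp; first exact: continuous_measurable_fun.
  by apply: measurable_funM => //; exact: measurable_funD.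
(* This rewrites the integral on the right-hand side; the constant derivative [a^-1] of [F] then
   cancels the factor [a]. *)
rewrite (@increasing_ge0_integration_by_substitutionT _ F G) //.
- rewrite F'E -ge0_integralZl//.
  + apply: eq_integral => x _; rewrite -EFinM; congr EFin.
    by rewrite !fctE /= mulrCA divff ?mulr1// gt_eqF.
  + apply/measurable_EFinP; apply: measurable_funM => //.
  + by move=> x _; rewrite lee_fin mulr_ge0 ?G0 ?invr_ge0 ?ltW.
  + by rewrite lee_fin ltW.
- by move=> x y xy; rewrite /F ltr_pM2r ?invr_gt0// ltrD2r.
- by rewrite F'E => ?; exact: cvg_cst.
- by rewrite F'E; exact: is_cvg_cst.
- by rewrite F'E; exact: is_cvg_cst.
- by apply/gt0_cvgMlNy; [rewrite invr_gt0|exact: cvg_addrr_Ny].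
- by apply/gt0_cvgMly; [rewrite invr_gt0|exact: cvg_addrr].
Qed.

(** Rescaling and folding by evenness reduce the integral to the arctangent integral over the half
    line. Every integrability claim about the kernel and the densities is dominated by this
    function. *)
Lemma integrable_oneDsqrV_affine (m a : R) : 0 < a ->
  mu.-integrable setT (fun x : R => ((oneDsqr ((x - m) / a))^-1)%:E).
Proof.
move=> a0; apply/integrableP; split.
  apply/measurable_EFinP; apply: (@measurableT_comp _ _ _ _ _ _ (fun x : R => (oneDsqr x)^-1)).
    by apply: continuous_measurable_fun; exact: continuous_oneDsqrV.
  by apply: measurable_funM => //; exact: measurable_funD.
have p0 (x : R) : 0 <= (oneDsqr x)^-1 by rewrite invr_ge0 (le_trans ler01)// oneDsqr_ge1.
under eq_integral do rewrite /= ger0_norm//.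
rewrite (ge0_integralT_affine _ _ (fun x : R => (oneDsqr x)^-1))//; last exact: continuous_oneDsqrV.
rewrite ge0_symfun_integralT//; last 2 first.
- exact: continuous_oneDsqrV.
- by move=> x /=; rewrite /oneDsqr sqrrN.
by rewrite -set_itvcy integral0y_oneDsqr -!EFinM ltry.
Qed.

End affine_substitution.

(** * The kernel exp(-|u|^b): continuity, decay, substitution *)

Lemma powR_continuous_gt0 {R : realType} (p x : R) : 0 < x -> {for x, continuous (@powR R ^~ p)}.
Proof.
move=> x0; apply: differentiable_continuous; apply/derivable1_diffP.
by apply: derivable_powR; rewrite in_itv/= andbT.
Qed.

Section generalized_gaussian_kernel.
Context {R : realType} (b : R).
Hypothesis b0 : 0 < b.
Let mu := @lebesgue_measure R.

Definition gg_kernel (u : R) : R := expR (- (`|u| `^ b)).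

Lemma gg_kernel_gt0 u : 0 < gg_kernel u. Proof. exact: expR_gt0. Qed.

Lemma gg_kernel_ge0 u : 0 <= gg_kernel u. Proof. exact: expR_ge0. Qed.

Lemma gg_kernel_le1 u : gg_kernel u <= 1.
Proof. by rewrite -expR0 ler_expR oppr_le0 powR_ge0. Qed.

Lemma continuous_gg_kernel : continuous gg_kernel.
Proof.
move=> u; rewrite /gg_kernel.
apply: (@continuous_comp _ _ _ (fun u : R => - (`|u| `^ b)) expR); last exact: continuous_expR.
apply: cvgN => /=.
have [->|u0] := eqVneq u 0; last first.
  apply: (@continuous_comp _ _ _ (fun u : R => `|u|) (@powR R ^~ b)).
    exact: norm_continuous.
  by apply: powR_continuous_gt0; rewrite normr_gt0.
rewrite normr0 powR0 ?gt_eqF//.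
apply/cvgrPdist_lt => e e0; near=> x.
rewrite sub0r normrN ger0_norm ?powR_ge0//.
have -> : e = (e `^ b^-1) `^ b by rewrite -powRrM mulVf ?gt_eqF// powRr1// ltW.
rewrite gt0_ltr_powR ?nnegrE ?powR_ge0//.
near: x; apply: (@nbhs0_lt _ R); exact: powR_gt0.
Unshelve. all: by end_near. Qed.

(** The factor [1 + |u|] makes room for integrands of linear growth. For v = |u| > 1, the Taylor
    bound exp(w) >= w^(n+1)/(n+1)! at w = v^b beats v^3. *)
Lemma gg_kernel_le_oneDsqrV :
  exists K : R, forall u, (1 + `|u|) * gg_kernel u <= K / oneDsqr u.
Proof.
(* The target 3 is the degree of (1 + v)(1 + v^2). *)
have [n nb] : exists n : nat, 3 <= b * n.+1%:R.
  exists (Num.truncn (3 / b)).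
  by rewrite mulrC -ler_pdivrMr// ltW// truncnS_gt.
(* The 4 serves both cases: (1 + v)(1 + v^2) is at most 4 for v <= 1 and at most 4 v^3 beyond. *)
exists (4 * n.+1`!%:R) => u.
have o1 : 0 < oneDsqr u by rewrite (lt_le_trans ltr01)// oneDsqr_ge1.
rewrite ler_pdivlMr//; set v := `|u|.
have v0 : 0 <= v by exact: normr_ge0.
have f1 : 1 <= n.+1`!%:R :> R by rewrite ler1n fact_gt0.
have -> : oneDsqr u = 1 + v ^+ 2 by rewrite /oneDsqr real_normK ?num_real.
have k0 := gg_kernel_ge0 u; have k1 := gg_kernel_le1 u.
have [v1|v1] := leP v 1.
  have : v ^+ 2 <= 1 by rewrite expr_le1.
  move: (v ^+ 2) (exprn_ge0 2 v0) => w w0 w1.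
  have A : (1 + v) * gg_kernel u <= 2 by nra.
  have B : 0 <= (1 + v) * gg_kernel u by rewrite mulr_ge0// addr_ge0.
  by nra.
have h : gg_kernel u * v ^+ 3 <= n.+1`!%:R.
  rewrite /gg_kernel -/v expRN mulrC ler_pdivrMr ?expR_gt0//.
  rewrite mulrC -ler_pdivrMr; last by rewrite (lt_le_trans ltr01).
  apply: le_trans; last exact: (le_trans _ (expR_ge1Dxn n (powR_ge0 v b))); rewrite ?powR_ge0//.
  have /(ler_powR (ltW v1)) : 3 <= b * n.+1%:R by [].
  rewrite powRrM !powR_mulrn ?powR_ge0// => H.
  apply: ler_wpDl => //; apply: ler_pM => //; first by rewrite exprn_ge0.
have v3 : (1 + v) * (1 + v ^+ 2) <= 4 * v ^+ 3.
  by rewrite !exprS expr0; nra.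
rewrite mulrAC; apply: le_trans (_ : 4 * v ^+ 3 * gg_kernel u <= _).
  by rewrite ler_wpM2r.
by rewrite -mulrA ler_pM2l// mulrC.
Qed.

(** The substitution is t = u^b. The interval stays away from 0, where t^(1/b - 1) is unbounded if b
    > 1 and the derivative b u^(b - 1) is unbounded if b < 1. *)
Lemma integral_powR_substitution (x y : R) : 0 < x -> x <= y ->
  (\int[mu]_(t in `[(x `^ b)%R, (y `^ b)%R]) (t `^ (b^-1 - 1) * expR (- t))%R%:E =
   \int[mu]_(u in `[x, y]) (b * gg_kernel u)%:E)%E.
Proof.
move=> x0 xy.
pose F (u : R) : R := u `^ b.
pose G (t : R) : R := t `^ (b^-1 - 1) * expR (- t).
have dF (u : R) : 0 < u -> is_derive u 1 F (b * u `^ (b - 1)).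
  by move=> u0; exact: is_derive1_powR.
have F'E (u : R) : 0 < u -> (F^`())%classic u = b * u `^ (b - 1).
  by move=> u0; rewrite derive1E; exact: (@derive_val _ _ _ _ _ _ _ (dF u u0)).
have cF' (u : R) : 0 < u -> (F^`())%classic z @[z --> u] --> (F^`())%classic u.
  move=> u0; rewrite F'E//.
  apply: (@cvg_trans _ ((b * z `^ (b - 1)) @[z --> u])).
    apply: near_eq_cvg; near=> z; rewrite F'E//.
    by near: z; exact: lt_nbhsr.
  apply: (@cvgM R R (nbhs u) _ (fun=> b) (fun z => z `^ (b - 1)) b); first exact: cvg_cst.
  exact: (powR_continuous_gt0 (b - 1) u u0).
have cF (u : R) : 0 < u -> {for u, continuous F} by exact: powR_continuous_gt0.
have y0 : 0 < y by exact: lt_le_trans xy.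
rewrite (@integration_by_substitution_increasing _ F G)//.
- apply: eq_integral => u; rewrite inE/= in_itv/= => /andP[xu uy].
  have u0 : 0 < u by exact: lt_le_trans xu.
  rewrite !fctE/= F'E// /G /F /gg_kernel gtr0_norm//; congr EFin.
  (* The exponents b (1/b - 1) and b - 1 sum to 0, so the derivative cancels the power of t up to
     the factor b. *)
  have H : (u `^ b) `^ (b^-1 - 1) * u `^ (b - 1) = 1.
    rewrite -powRrM -powRD; last by rewrite (gt_eqF u0) implybT.
    rewrite (_ : _ + _ = 0) ?powRr0//.
    by field; rewrite gt_eqF.
  by rewrite mulrCA mulrAC H mul1r.
- move=> u v; rewrite !in_itv/= => /andP[xu uy] /andP[xv vy] uv.
  by rewrite /F gt0_ltr_powR// nnegrE ltW// (lt_le_trans x0).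
- by move=> u; rewrite in_itv/= => /andP[xu uy]; apply: cF'; exact: lt_trans xu.
- by apply/cvg_ex; exists ((F^`())%classic x); apply: cvg_at_right_filter; exact: cF'.
- by apply/cvg_ex; exists ((F^`())%classic y); apply: cvg_at_left_filter; exact: cF'.
- split.
  + move=> u; rewrite in_itv/= => /andP[xu uy].
    by apply: ex_derive; apply: dF; exact: lt_trans xu.
  + by apply: cvg_at_right_filter; exact: cF.
  + by apply: cvg_at_left_filter; exact: cF.
- apply: continuous_in_subspaceT => t; rewrite inE/= in_itv/= => /andP[xt _].
  have t0 : 0 < t by apply: lt_le_trans xt; exact: powR_gt0.
  apply: cvgM; first exact: powR_continuous_gt0.
  apply: (@continuous_comp _ _ _ (fun u : R => - u) expR).
    exact: opp_continuous.
  exact: continuous_expR.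
Unshelve. all: by end_near. Qed.

End generalized_gaussian_kernel.

(** * Monotonicity and positivity of integrals, interval indicators *)

Section integral_lemmas.
Context {R : realType}.
Let mu := @lebesgue_measure R.

(* The integral of a nonnegative function is a supremum over the simple functions
   below it, hence it is monotone even on non-measurable functions. *)
Lemma ge0_le_Rint (f g : R -> R) : (forall x, 0 <= f x) -> (forall x, f x <= g x) ->
  mu.-integrable setT (EFin \o g) -> Defs.Rint f <= Defs.Rint g.
Proof.
move=> f0 fg ig.
have g0 x : 0 <= g x := le_trans (f0 x) (fg x).
have le : (\int[mu]_x (f x)%:E <= \int[mu]_x (g x)%:E)%E.
  rewrite !ge0_integralTE; try by move=> x; rewrite lee_fin.
  apply: ereal_sup_le => _ [h hf <-]; exists h => // x.
  by rewrite (le_trans (hf x))// lee_fin.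
have gfin : (\int[mu]_x (g x)%:E)%E \is a fin_num by exact: integrable_fin_num.
rewrite /Defs.Rint /Rintegral; apply: fine_le => //.
rewrite ge0_fin_numE ?(le_lt_trans le)//; first by rewrite ltey_eq gfin.
by apply: integral_ge0 => x _; rewrite lee_fin.
Qed.

(** If the integral vanished, [f] would be 0 almost everywhere, and [x, y] would be negligible
    despite its positive length. *)
Lemma Rint_gt0 (f : R -> R) (x y : R) : x < y -> (forall z, 0 <= f z) ->
  (forall z, x <= z <= y -> 0 < f z) ->
  mu.-integrable setT (EFin \o f) -> 0 < Defs.Rint f.
Proof.
move=> xy f0 fp iF.
rewrite lt_neqAle; apply/andP; split; last exact: Rintegral_ge0.
apply/eqP => I0.
have If : (\int[mu]_z `|(f z)%:E| = 0)%E.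
  under eq_integral do rewrite gee0_abs ?lee_fin//.
  rewrite -[LHS]fineK; first by rewrite -[fine _]/(Defs.Rint f) -I0.
  exact: integrable_fin_num.
have mf : measurable_fun setT (EFin \o f) by case/integrableP: iF.
have [/(_ If) H _] := ae_eq_integral_abs (@lebesgue_measure R) measurableT mf.
have N : mu.-negligible (`[x, y] : set R).
  apply: negligibleS H => z /= /fp fz /(_ I) [] fz0.
  by rewrite fz0 ltxx in fz.
have : (@lebesgue_measure R `[x, y] = 0)%E.
  by apply: measure_negligible => //; exact: measurable_itv.
by rewrite /mu lebesgue_measure_itv/= lte_fin xy -EFinB => -[] /eqP;
  rewrite subr_eq0 gt_eqF.
Qed.

Lemma Rint_itv (M x y : R) : 0 <= M -> x <= y ->
  Defs.Rint (fun z : R => M * (x <= z <= y)%R%:R) = M * (y - x).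
Proof.
move=> M0 xy; rewrite /Defs.Rint.
have E (z : R) : (x <= z <= y)%R%:R = \1_`[x, y] z :> R.
  by rewrite indicE; congr (nat_of_bool _)%:R; rewrite mem_setE in_itv.
under eq_Rintegral do rewrite E.
rewrite RintegralZl//; last exact: integrable_indic_itv.
rewrite /Rintegral integral_indic// setIT.
rewrite -[X in fine X]/(@lebesgue_measure R `[x, y]) lebesgue_measure_itv/= lte_fin.
move: xy; rewrite le_eqVlt => /predU1P[->|xy]; first by rewrite ltxx subrr.
by rewrite xy.
Qed.

Lemma integrable_itv (M x y : R) :
  mu.-integrable setT (EFin \o (fun z : R => M * (x <= z <= y)%R%:R)).
Proof.
have E : (EFin \o (fun z : R => M * (x <= z <= y)%R%:R)) =
   (fun z => M%:E * (\1_`[x, y] z)%:E)%E.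
  apply/funext => z /=; rewrite EFinM indicE; congr (_ * _%:R%:E)%E.
  by rewrite mem_setE in_itv.
by rewrite E; apply: integrableZl => //; exact: integrable_indic_itv.
Qed.

End integral_lemmas.

(** * The Gamma integral and the total mass of the kernel *)

Section gamma_kernel.
Context {R : realType} (b : R).
Hypothesis b0 : 0 < b.
Let mu := @lebesgue_measure R.

Lemma measurable_gg_kernel : measurable_fun setT (gg_kernel b).
Proof. by apply: continuous_measurable_fun; exact: continuous_gg_kernel. Qed.

(** The half line is exhausted by the compact intervals [S n] and by their images [T n] under u^b.
    The substitution holds on each of them, and monotone convergence passes to the limit on both
    sides. *)
Lemma integral_gamma_gg_kernel :
  (\int[mu]_(t in `]0%R, +oo[) (t `^ (b^-1 - 1) * expR (- t))%R%:E =
   \int[mu]_(u in `]0%R, +oo[) (b * gg_kernel b u)%:E)%E.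
Proof.
pose S (n : nat) : set R := `[n.+1%:R^-1, n.+1%:R]%classic.
pose T (n : nat) : set R := `[n.+1%:R^-1 `^ b, n.+1%:R `^ b]%classic.
have n0 (n : nat) : 0 < n.+1%:R :> R by [].
have in0 (n : nat) : 0 < n.+1%:R^-1 :> R by rewrite invr_gt0.
have inle (n : nat) : n.+1%:R^-1 <= n.+1%:R :> R.
  apply: (@le_trans _ _ 1); last by rewrite ler1n.
  by rewrite invf_le1// ler1n.
have inS (x : R) : 0 < x -> exists n : nat, n.+1%:R^-1 <= x <= n.+1%:R.
  move=> x0; exists (maxn (Num.truncn x) (Num.truncn x^-1)); apply/andP; split.
    rewrite invf_ple ?posrE// ltW// (lt_le_trans (truncnS_gt _))// ler_nat ltnS.
    exact: leq_maxr.
  by rewrite ltW// (lt_le_trans (truncnS_gt _))// ler_nat ltnS leq_maxl.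
have US : \bigcup_n S n = `]0%R, +oo[%classic.
  apply/seteqP; split => x /=.
    by move=> [n _] /=; rewrite !in_itv/= andbT => /andP[+ _]; exact: lt_le_trans (in0 n).
  by rewrite in_itv/= andbT => /inS[n xn]; exists n => //=; rewrite in_itv.
have UT : \bigcup_n T n = `]0%R, +oo[%classic.
  apply/seteqP; split => x /=.
    move=> [n _] /=; rewrite !in_itv/= andbT => /andP[+ _].
    exact: lt_le_trans (powR_gt0 b (in0 n)).
  rewrite in_itv/= andbT => x0.
  have [n /andP[nx xn]] := inS _ (powR_gt0 b^-1 x0).
  have xE : x = (x `^ b^-1) `^ b by rewrite -powRrM mulVf ?gt_eqF// powRr1// ltW.
  exists n => //; rewrite /T /= ?in_itv/= xE !ge0_ler_powR ?nnegrE ?powR_ge0 ?(ltW b0) ?(ltW (n0 _)) ?(ltW (in0 _))//.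
have ndS : nondecreasing_seq S.
  move=> m n mn; rewrite subsetEset => x; rewrite /S /= !in_itv/= => /andP[mx xm].
  rewrite (le_trans xm) ?ler_nat ?ltnS// andbT (le_trans _ mx)//.
  by rewrite lef_pV2 ?posrE// ler_nat ltnS.
have ndT : nondecreasing_seq T.
  move=> m n mn; rewrite subsetEset => x; rewrite /T /= !in_itv/= => /andP[mx xm].
  apply/andP; split.
    apply: le_trans mx; apply: ge0_ler_powR; rewrite ?nnegrE ?(ltW b0)//.
    by rewrite lef_pV2 ?posrE// ler_nat ltnS.
  apply: (le_trans xm); apply: ge0_ler_powR; rewrite ?nnegrE ?(ltW b0)//.
  by rewrite ler_nat ltnS.
rewrite -{1}UT -US.
have cvgT : (\int[mu]_(t in T n) (t `^ (b^-1 - 1) * expR (- t))%R%:E)%E @[n --> \oo] -->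
  (\int[mu]_(t in \bigcup_n T n) (t `^ (b^-1 - 1) * expR (- t))%R%:E)%E.
  apply: ge0_nondecreasing_set_cvg_integral => //.
  - by move=> n; exact: measurable_itv.
  - move=> n; apply: measurable_funTS; apply/measurable_EFinP/measurable_funM.
      exact: measurable_powR.
    by apply: measurableT_comp => //; exact: measurable_expR.
  - by move=> n x _; rewrite lee_fin mulr_ge0 ?powR_ge0 ?expR_ge0.
have cvgS : (\int[mu]_(u in S n) (b * gg_kernel b u)%R%:E)%E @[n --> \oo] -->
  (\int[mu]_(u in \bigcup_n S n) (b * gg_kernel b u)%R%:E)%E.
  apply: ge0_nondecreasing_set_cvg_integral => //.
  - by move=> n; exact: measurable_itv.
  - move=> n; apply: measurable_funTS; apply/measurable_EFinP/measurable_funM => //.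
    exact: measurable_gg_kernel.
  - by move=> n x _; rewrite lee_fin mulr_ge0 ?gg_kernel_ge0 ?ltW.
have TS : (fun n => (\int[mu]_(t in T n) (t `^ (b^-1 - 1) * expR (- t))%R%:E)%E) =
  (fun n => (\int[mu]_(u in S n) (b * gg_kernel b u)%R%:E)%E).
  by apply/funext => n; exact: integral_powR_substitution.
move: cvgT; rewrite TS => cvgT.
exact: (cvg_unique (@ereal_hausdorff R) cvgT cvgS).
Qed.

Lemma integrable_gg_kernel : mu.-integrable setT (EFin \o gg_kernel b).
Proof.
have [K HK] := gg_kernel_le_oneDsqrV b b0.
have := integrable_oneDsqrV_affine (0 : R) (1 : R) ltr01.
move=> /(integrableZl measurableT K); apply: le_integrable => //.
  by apply/measurable_EFinP; exact: measurable_gg_kernel.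
move=> x _ /=; rewrite lee_fin subr0 divr1 ger0_norm ?gg_kernel_ge0//.
apply: le_trans (ler_norm _); apply: le_trans (HK x).
by rewrite ler_peMl ?gg_kernel_ge0// lerDl.
Qed.

Lemma Rint_gg_kernel_gt0 : 0 < Defs.Rint (gg_kernel b).
Proof.
apply: (Rint_gt0 _ 0 1) => // *; [exact: gg_kernel_ge0|exact: gg_kernel_gt0|].
exact: integrable_gg_kernel.
Qed.

(** The substitution gives the integral over the half line; evenness of the kernel supplies the
    factor 2. This identity normalizes the density. *)
Lemma Gamma_gg_kernel : 2 * Gamma b^-1 = b * Defs.Rint (gg_kernel b).
Proof.
rewrite /Gamma /Defs.Rint /Rintegral integral_gamma_gg_kernel.
have mk D : measurable_fun D (EFin \o gg_kernel b).
  by apply: measurable_funTS; apply/measurable_EFinP; exact: measurable_gg_kernel.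
have -> : (\int[mu]_(u in `]0%R, +oo[) (b * gg_kernel b u)%:E =
    b%:E * \int[mu]_(u in `]0%R, +oo[) (gg_kernel b u)%:E)%E.
  rewrite -ge0_integralZl//; first exact: mk.
  - by move=> x _; rewrite lee_fin gg_kernel_ge0.
  - by rewrite lee_fin ltW.
rewrite integral_itv_obnd_cbnd; last exact: mk.
rewrite [in RHS]ge0_symfun_integralT; last 3 first.
- exact: gg_kernel_ge0.
- exact: continuous_gg_kernel.
- by move=> x; rewrite /gg_kernel /= normrN.
rewrite -set_itvcy.
have fin : (\int[mu]_(x in `[0%R, +oo[) (gg_kernel b x)%:E)%E \is a fin_num.
  apply: integrable_fin_num => //; apply: integrableS integrable_gg_kernel => //.
by rewrite !fineM//= mulrCA.
Qed.

Lemma Gamma_gt0 : 0 < Gamma b^-1.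
Proof.
by rewrite -(pmulr_rgt0 _ (ltr0n R 2)) Gamma_gg_kernel mulr_gt0// Rint_gg_kernel_gt0.
Qed.

End gamma_kernel.

(** * Functions of linear growth and the sign classifier *)

Section linear_growth.
Context {R : realType}.

(** One class covering all integrands at hand: the distances |x - y + theta_star|, the sign and the
    error indicators. It is stable under linear combinations and norms, and integrable against the
    densities. *)
Definition linear_growth (h : R -> R) : Prop :=
  measurable_fun setT h /\ exists A : R, forall x, `|h x| <= A * (1 + `|x|).

Lemma linear_growth_cst (c : R) : linear_growth (fun=> c).
Proof.
split; first exact: measurable_cst.
by exists `|c| => x; rewrite ler_peMr// lerDl.
Qed.

Lemma linear_growth_id : linear_growth id.
Proof. by split; [exact: measurable_id|exists 1 => x; rewrite mul1r lerDr]. Qed.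

Lemma linear_growthD (f g : R -> R) : linear_growth f -> linear_growth g ->
  linear_growth (fun x => f x + g x).
Proof.
move=> [mf [A fA]] [mg [B gB]]; split; first exact: measurable_funD.
exists (A + B) => x; rewrite mulrDl (le_trans (ler_normD _ _))//.
by rewrite lerD.
Qed.

Lemma linear_growthM (c : R) (f : R -> R) : linear_growth f ->
  linear_growth (fun x => c * f x).
Proof.
move=> [mf [A fA]]; split; first exact: measurable_funM.
by exists (`|c| * A) => x; rewrite normrM -mulrA ler_wpM2l.
Qed.

Lemma linear_growth_norm (f : R -> R) : linear_growth f ->
  linear_growth (fun x => `|f x|).
Proof.
move=> [mf [A fA]]; split; last by exists A => x; rewrite normr_id.
by apply: measurableT_comp => //; exact: normr_measurable.
Qed.

Lemma linear_growth_nondecreasing (f : R -> R) : {homo f : x y / x <= y} ->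
  (forall x, `|f x| <= 1) -> linear_growth f.
Proof.
move=> hf f1; split; first exact: nondecreasing_measurable.
by exists 1 => x; rewrite mul1r (le_trans (f1 x))// lerDl.
Qed.

Lemma fsign_norm (theta x : R) : `|fsign theta x| <= 1.
Proof. by rewrite /fsign normr_sg; case: (_ != 0). Qed.

Lemma fsign_homo (theta : R) : {homo fsign theta : x y / x <= y}.
Proof.
move=> x y xy; rewrite /fsign.
have : x + theta <= y + theta by rewrite lerD2r.
by case: sgrP; case: sgrP => //; lra.
Qed.

Lemma linear_growth_fsign (theta : R) : linear_growth (fsign theta).
Proof. exact: linear_growth_nondecreasing (fsign_homo theta) (fsign_norm theta). Qed.

(** At [x = - theta] the sign is 0 and differs from both labels, hence the large inequality here and
    in [fsign_ne1]. *)
Lemma fsign_neN1 (theta x : R) : (fsign theta x != -1) = (- theta <= x).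
Proof.
rewrite /fsign; case: sgrP => h.
- by rewrite eq_sym oppr_eq0 oner_eq0; lra.
- by rewrite gt_eqF; lra.
- by rewrite eqxx; apply/esym/negbTE; lra.
Qed.

Lemma fsign_ne1 (theta x : R) : (fsign theta x != 1) = (x <= - theta).
Proof.
rewrite /fsign; case: sgrP => h.
- by rewrite eq_sym oner_eq0; lra.
- by rewrite eqxx; apply/esym/negbTE; lra.
- by rewrite lt_eqF; lra.
Qed.

Lemma linear_growth_neN1 (theta : R) :
  linear_growth (fun x => (fsign theta x != -1)%:R).
Proof.
apply: linear_growth_nondecreasing => [x y xy|x]; last by case: (_ != _); rewrite ?normr1 ?normr0.
rewrite !fsign_neN1 ler_nat; case: (leP _ x) => // h.
by rewrite (le_trans h xy).
Qed.

Lemma linear_growth_ne1 (theta : R) :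
  linear_growth (fun x => (fsign theta x != 1)%:R).
Proof.
(* This error indicator is nonincreasing in [x], so it is written as 1 minus a nondecreasing one. *)
rewrite (_ : (fun _ => _) = fun x => 1 + (-1) * (- theta < x)%R%:R :> R); last first.
  by apply/funext => x; rewrite fsign_ne1 ltNge; case: leP => _ /=; lra.
apply: linear_growthD; first exact: linear_growth_cst.
apply: linear_growthM; apply: linear_growth_nondecreasing => [x y xy|x].
  by rewrite ler_nat; case: (ltP _ x) => // h; rewrite (lt_le_trans h xy).
by case: (_ < _); rewrite ?normr1 ?normr0.
Qed.

End linear_growth.

(** The arithmetic core of [norm_affine_le], with the norms abstracted into variables. *)
Lemma affine_bound (R : realType) (X M U a : R) : 0 < a -> 0 <= M -> 0 <= U ->
  X <= M + a * U -> 1 + X <= (1 + M + a) * (1 + U).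
Proof. by move=> a0 M0 U0 H; nra. Qed.

(** * The generalized Gaussian density and its mean operator *)

Section gg_pdf_theory.
Context {R : realType} (m a b : R).
Hypotheses (a0 : 0 < a) (b0 : 0 < b).
Let mu := @lebesgue_measure R.

(** The value of the density at its center [m]; it becomes the constant C1'. *)
Definition gg_peak : R := b / (2 * a * Gamma b^-1).

Lemma gg_peak_gt0 : 0 < gg_peak.
Proof. by rewrite divr_gt0// !mulr_gt0// Gamma_gt0. Qed.

Lemma gg_pdfE x : gg_pdf m a b x = gg_peak * gg_kernel b ((x - m) / a).
Proof. by rewrite /gg_pdf /gg_kernel normrM [`|a^-1|]gtr0_norm// invr_gt0. Qed.

Lemma gg_pdf_gt0 x : 0 < gg_pdf m a b x.
Proof. by rewrite gg_pdfE mulr_gt0 ?gg_peak_gt0 ?gg_kernel_gt0. Qed.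

Lemma gg_pdf_ge0 x : 0 <= gg_pdf m a b x.
Proof. exact/ltW/gg_pdf_gt0. Qed.

Lemma gg_pdf_le_peak x : gg_pdf m a b x <= gg_peak.
Proof. by rewrite gg_pdfE ler_piMr ?gg_kernel_le1// ltW// gg_peak_gt0. Qed.

Lemma measurable_gg_pdf : measurable_fun setT (gg_pdf m a b).
Proof.
rewrite (_ : gg_pdf m a b = fun x => gg_peak * gg_kernel b ((x - m) / a)); last first.
  by apply/funext => x; rewrite gg_pdfE.
apply: measurable_funM => //.
apply: (@measurableT_comp _ _ _ _ _ _ (gg_kernel b)); first exact: measurable_gg_kernel.
by apply: measurable_funM => //; exact: measurable_funD.
Qed.

Lemma norm_affine_le (x : R) :
  1 + `|x| <= (1 + `|m| + a) * (1 + `|(x - m) / a|).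
Proof.
set u : R := (x - m) / a.
have xE : x = m + a * u by rewrite /u mulrC divfK ?gt_eqF//; ring.
have xmu : `|x| <= `|m| + a * `|u|.
  by rewrite {1}xE (le_trans (ler_normD _ _))// normrM [`|a|]gtr0_norm.
exact: affine_bound.
Qed.

Lemma integrable_linear_growth (h : R -> R) : linear_growth h ->
  mu.-integrable setT (EFin \o (fun x => h x * gg_pdf m a b x)).
Proof.
move=> [mh [A hA]].
have [K HK] := gg_kernel_le_oneDsqrV b b0.
have A0 : 0 <= A.
  have := hA 0; rewrite normr0 addr0 mulr1; exact: le_trans.
(* The factors come from the growth of [h], the passage from x to (x - m)/a, the normalization, and
   the decay of the kernel. *)
pose C := A * (1 + `|m| + a) * gg_peak * K.
have H (x : R) : `|h x * gg_pdf m a b x| <= C * (oneDsqr ((x - m) / a))^-1.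
  set u := (x - m) / a.
  rewrite normrM [`|gg_pdf _ _ _ _|]ger0_norm ?gg_pdf_ge0// gg_pdfE -/u.
  have xu : 1 + `|x| <= (1 + `|m| + a) * (1 + `|u|) by exact: norm_affine_le.
  have p0 := gg_peak_gt0.
  apply: (@le_trans _ _ (A * (1 + `|m| + a) * gg_peak * ((1 + `|u|) * gg_kernel b u))); last first.
    rewrite /C -[leRHS]mulrA ler_wpM2l ?HK//; apply: mulr_ge0; last exact: ltW.
    by rewrite mulr_ge0// !addr_ge0// ltW.
  have k0 := gg_kernel_ge0 b u.
  have -> : A * (1 + `|m| + a) * gg_peak * ((1 + `|u|) * gg_kernel b u) =
    A * ((1 + `|m| + a) * (1 + `|u|)) * (gg_peak * gg_kernel b u) by ring.
  apply: ler_wpM2r; first by apply: mulr_ge0 => //; exact: ltW.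
  by rewrite (le_trans (hA x))// ler_wpM2l.
have /(integrableZl measurableT C) := integrable_oneDsqrV_affine m a a0.
apply: le_integrable => //.
  by apply/measurable_EFinP; apply: measurable_funM => //; exact: measurable_gg_pdf.
by move=> x _ /=; rewrite lee_fin (le_trans (H x))// ler_norm.
Qed.

Definition gg_mean (h : R -> R) : R := Defs.Rint (fun x => h x * gg_pdf m a b x).

(** The affine substitution yields a factor [a] and [Gamma_gg_kernel] evaluates the kernel integral;
    together they cancel the peak. *)
Lemma gg_mean1 : gg_mean (fun=> 1) = 1.
Proof.
have J0 := Rint_gg_kernel_gt0 b b0.
rewrite /gg_mean /Defs.Rint /Rintegral.
have -> : (\int[mu]_x (1 * gg_pdf m a b x)%:E =
    gg_peak%:E * \int[mu]_x (gg_kernel b ((x - m) / a))%:E)%E.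
  rewrite -ge0_integralZl//.
  - by apply: eq_integral => x _; rewrite mul1r gg_pdfE EFinM.
  - apply/measurable_EFinP; apply: (@measurableT_comp _ _ _ _ _ _ (gg_kernel b)).
      exact: measurable_gg_kernel.
    by apply: measurable_funM => //; exact: measurable_funD.
  - by move=> x _; rewrite lee_fin gg_kernel_ge0.
  - by rewrite lee_fin ltW// gg_peak_gt0.
rewrite ge0_integralT_affine//; last 2 first.
- exact: continuous_gg_kernel.
- exact: gg_kernel_ge0.
rewrite muleA -EFinM fineM//; last by apply: integrable_fin_num => //; exact: integrable_gg_kernel.
rewrite -[fine (integral _ _ _)]/(Defs.Rint (gg_kernel b)) /= /gg_peak.
rewrite (mulrAC 2) Gamma_gg_kernel//.
by field; rewrite !gt_eqF.
Qed.

Lemma gg_meanD (f g : R -> R) : linear_growth f -> linear_growth g ->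
  gg_mean (fun x => f x + g x) = gg_mean f + gg_mean g.
Proof.
move=> lf lg; rewrite /gg_mean /Defs.Rint -RintegralD//.
- by apply: eq_Rintegral => x _; rewrite mulrDl.
- exact: integrable_linear_growth.
- exact: integrable_linear_growth.
Qed.

Lemma gg_meanM (c : R) (f : R -> R) : linear_growth f ->
  gg_mean (fun x => c * f x) = c * gg_mean f.
Proof.
move=> lf; rewrite /gg_mean /Defs.Rint -RintegralZl//.
- by apply: eq_Rintegral => x _; rewrite mulrA.
- exact: integrable_linear_growth.
Qed.

Lemma gg_mean_cst (c : R) : gg_mean (fun=> c) = c.
Proof.
rewrite -[RHS]mulr1 -gg_mean1 -gg_meanM; last exact: linear_growth_cst.
by under [in RHS]eq_fun do rewrite mulr1.
Qed.

Lemma gg_mean_ge0 (f : R -> R) : (forall x, 0 <= f x) -> 0 <= gg_mean f.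
Proof. by move=> f0; apply: Rintegral_ge0 => x _; rewrite mulr_ge0 ?gg_pdf_ge0. Qed.

Lemma gg_mean_le (f g : R -> R) : (forall x, 0 <= f x) -> (forall x, f x <= g x) ->
  linear_growth g -> gg_mean f <= gg_mean g.
Proof.
move=> f0 fg lg; apply: ge0_le_Rint.
- by move=> x; rewrite mulr_ge0 ?gg_pdf_ge0.
- by move=> x; rewrite ler_wpM2r ?gg_pdf_ge0.
- exact: integrable_linear_growth.
Qed.

Lemma gg_mean_gt0 (f : R -> R) (x y : R) : x < y -> (forall z, 0 <= f z) ->
  (forall z, x <= z <= y -> 0 < f z) -> linear_growth f -> 0 < gg_mean f.
Proof.
move=> xy f0 fp lf; apply: (Rint_gt0 _ _ _ xy).
- by move=> z; rewrite mulr_ge0 ?gg_pdf_ge0.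
- by move=> z /fp ?; rewrite mulr_gt0 ?gg_pdf_gt0.
- exact: integrable_linear_growth.
Qed.

(** The excess lives on one interval, whose mass is at most the peak times its length. That product
    is itself written as an integral, so the comparison becomes pointwise. *)
Lemma gg_mean_itv_le (f g : R -> R) (x y : R) : x <= y ->
  linear_growth f -> linear_growth g ->
  (forall z, f z <= g z + (x <= z <= y)%R%:R) ->
  gg_mean f <= gg_mean g + gg_peak * (y - x).
Proof.
move=> xy lf lg fg; have p0 := ltW gg_peak_gt0.
rewrite -Rint_itv// -lerBlDl /gg_mean /Defs.Rint -RintegralB//; last 2 first.
- exact: integrable_linear_growth.
- exact: integrable_linear_growth.
apply: le_Rintegral => //.
- have := integrableB measurableT (integrable_linear_growth f lf)
    (integrable_linear_growth g lg).
  by apply: eq_integrable => // z _ /=; rewrite EFinB.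
- exact: integrable_itv.
move=> z _; rewrite -mulrBl.
apply: (@le_trans _ _ ((x <= z <= y)%R%:R * gg_pdf m a b z)).
  by rewrite ler_wpM2r ?gg_pdf_ge0// lerBlDl.
by rewrite mulrC ler_wpM2r// gg_pdf_le_peak.
Qed.

End gg_pdf_theory.

(** * The mixture: loss, label distances and the iteration *)

Section mixture.
Context {R : realType} (mu1 mu2 a b : R).
Hypotheses (a0 : 0 < a) (b0 : 0 < b).

Let E := EG mu1 mu2 a b.
Let L := loss mu1 mu2 a b.
Let ts := theta_star mu1 mu2.

Lemma EGE (h : R -> R -> R) : EG mu1 mu2 a b h =
  2^-1 * gg_mean mu1 a b (h^~ (-1)) + 2^-1 * gg_mean mu2 a b (h^~ 1).
Proof. by []. Qed.

(** Constants pass through because both densities have mass 1. The shape is that of the bound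
    averaged in [exp_loss_le]. *)
Lemma EG_lin (c u v : R) (U V : R -> R -> R) :
  (forall y, linear_growth (U^~ y)) -> (forall y, linear_growth (V^~ y)) ->
  E (fun x y => c + (u * U x y + v * V x y)) = c + (u * E U + v * E V).
Proof.
move=> lU lV; have lc := @linear_growth_cst R c.
have lUV y : linear_growth (fun x => u * U x y + v * V x y).
  by apply: linear_growthD; exact: linear_growthM.
have M m y : gg_mean m a b (fun x => c + (u * U x y + v * V x y)) =
    c + (u * gg_mean m a b (U^~ y) + v * gg_mean m a b (V^~ y)).
  rewrite (gg_meanD m a b a0 b0 (fun=> c) (fun x => u * U x y + v * V x y))// gg_mean_cst//.
  rewrite (gg_meanD m a b a0 b0 (fun x => u * U x y) (fun x => v * V x y)); try exact: linear_growthM.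
  by rewrite !gg_meanM.
have halves (p q r s : R) : 2^-1 * (c + (u * p + v * q)) + 2^-1 * (c + (u * r + v * s)) =
    c + (u * (2^-1 * p + 2^-1 * r) + v * (2^-1 * q + 2^-1 * s)) by field.
by rewrite /E !EGE !M halves.
Qed.

Lemma EG_ge0 (h : R -> R -> R) : (forall x y, 0 <= h x y) -> 0 <= E h.
Proof. by move=> h0; rewrite /E EGE addr_ge0// mulr_ge0 ?invr_ge0// gg_mean_ge0. Qed.

(** Regularity is carried by [g], because [f] will be the iterated expectation [exp_loss], known
    only to be nonnegative. *)
Lemma EG_le (f g : R -> R -> R) : (forall x y, 0 <= f x y) ->
  (forall x y, f x y <= g x y) -> (forall y, linear_growth (g^~ y)) -> E f <= E g.
Proof.
by move=> f0 fg lg; rewrite /E !EGE lerD// ler_wpM2l ?invr_ge0// gg_mean_le.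
Qed.

(** For each label the two error sets are half-lines on the same side, ending at [- theta] and
    [- theta'], so they differ only between these ends. *)
Lemma loss_lipschitz (theta theta' : R) :
  L theta - L theta' <= gg_peak a b * `|theta - theta'|.
Proof.
have halves (p p' q q' d : R) : p <= p' + d -> q <= q' + d ->
  (2^-1 * p + 2^-1 * q) - (2^-1 * p' + 2^-1 * q') <= d by lra.
pose x := Num.min (- theta) (- theta'); pose y := Num.max (- theta) (- theta').
have xy : x <= y by rewrite /x /y ge_min !le_max lexx.
have yxE : y - x = `|theta - theta'|.
  rewrite /x /y; case: (leP (- theta) (- theta')) => h.
    by rewrite ger0_norm; lra.
  by rewrite ltr0_norm; lra.
have H1 : gg_mean mu1 a b (fun x => (fsign theta x != -1)%:R) <=
    gg_mean mu1 a b (fun x => (fsign theta' x != -1)%:R) + gg_peak a b * (y - x).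
  apply: gg_mean_itv_le => //; try exact: linear_growth_neN1.
  move=> z; rewrite !fsign_neN1 -natrD ler_nat /x /y ge_min le_max.
  by case: (leP (- theta) z) => h1; case: (leP (- theta') z) => h2 //=; rewrite (ltW h2) orbT.
have H2 : gg_mean mu2 a b (fun x => (fsign theta x != 1)%:R) <=
    gg_mean mu2 a b (fun x => (fsign theta' x != 1)%:R) + gg_peak a b * (y - x).
  apply: gg_mean_itv_le => //; try exact: linear_growth_ne1.
  move=> z; rewrite !fsign_ne1 -natrD ler_nat /x /y ge_min le_max.
  by case: (leP z (- theta)) => h1; case: (leP z (- theta')) => h2 //=; rewrite (ltW h2) orbT.
by rewrite -yxE; exact: halves H1 H2.
Qed.

Let U (x y : R) : R := `|x - y + ts|.
Let V (x y : R) : R := `|x - fsign ts x + ts|.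

Lemma linear_growth_dist (y : R) : linear_growth (U^~ y).
Proof.
apply: linear_growth_norm; apply: linear_growthD; last exact: linear_growth_cst.
by apply: linear_growthD; [exact: linear_growth_id|exact: linear_growth_cst].
Qed.

Lemma linear_growth_dist_fsign (y : R) : linear_growth (V^~ y).
Proof.
apply: linear_growth_norm; apply: linear_growthD; last exact: linear_growth_cst.
apply: linear_growthD; first exact: linear_growth_id.
under eq_fun do rewrite -mulN1r.
by apply: linear_growthM; exact: linear_growth_fsign.
Qed.

(** With z = x + theta_star, the sign of a nonzero z is the point of {-1, 1} nearest to z; at z = 0
    the sign is 0 and the left side vanishes. *)
Lemma dist_fsign_le (x y : R) : `|y| = 1 -> V x y <= U x y.
Proof.
rewrite /V /U /fsign => y1.
have -> : x - y + ts = (x + ts) - y by ring.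
rewrite addrAC; move: (x + ts) => z.
have [->|->] : y = 1 \/ y = -1 by case: (ger0P y) y1 => _ y1; [left|right; lra].
  case: sgrP => [->|z0|z0]; first by rewrite subr0 normr0.
  - by [].
  - by case: (ger0P (z - -1)) => h1; case: (ger0P (z - 1)) => h2; lra.
case: sgrP => [->|z0|z0]; first by rewrite subr0 normr0.
- by case: (ger0P (z - 1)) => h1; case: (ger0P (z - -1)) => h2; lra.
- by [].
Qed.

(** Strictness is drawn from the label -1 alone; the label 1 contributes a weak inequality. *)
Lemma EG_dist_gt : 0 < E U - E V.
Proof.
have halves (p p' q q' : R) : 0 < p + (-1) * p' -> q' <= q ->
  0 < (2^-1 * p + 2^-1 * q) - (2^-1 * p' + 2^-1 * q') by lra.
have N1 : `|(-1 : R)| = 1 by rewrite normrN normr1.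
have le m y : `|y| = 1 -> gg_mean m a b (V^~ y) <= gg_mean m a b (U^~ y).
  move=> y1; apply: (gg_mean_le m a b a0 b0 _ _ _ _ (linear_growth_dist y)) => x.
    exact: normr_ge0.
  exact: dist_fsign_le.
have lt : 0 < gg_mean mu1 a b (fun x => U x (-1) + (-1) * V x (-1)).
  (* On this interval z = x + theta_star lies in [1, 2], where the distances are z + 1 and z - 1,
     with gap 2. *)
  apply: (gg_mean_gt0 mu1 a b a0 b0 _ (1 - ts) (2 - ts)); first by lra.
  - by move=> z; have := dist_fsign_le z (-1) N1; lra.
  - move=> z /andP[z1 z2]; rewrite /U /V /fsign gtr0_sg; last by lra.
    rewrite ger0_norm; last by lra.
    by rewrite ger0_norm; lra.
  - apply: linear_growthD; first exact: linear_growth_dist.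
    by apply: linear_growthM; exact: linear_growth_dist_fsign.
rewrite gg_meanD// in lt; last 2 first.
- exact: linear_growth_dist.
- by apply: linear_growthM; exact: linear_growth_dist_fsign.
rewrite gg_meanM// in lt; last exact: linear_growth_dist_fsign.
exact: halves lt (le mu2 1 (normr1 _)).
Qed.

Lemma exp_loss_ge0 (rho eta : R) t theta0 : 0 <= exp_loss mu1 mu2 a b rho eta t theta0.
Proof. by elim: t theta0 => [|t IH] theta0 /=; apply: EG_ge0 => x y. Qed.

Lemma exp_loss_le (rho eta theta0 : R) (t : nat) : 0 <= rho <= 1 -> 0 < eta < 1 ->
  exp_loss mu1 mu2 a b rho eta t theta0 - L ts <=
  gg_peak a b * `|theta0 - ts| * (1 - eta) ^+ t +
  (1 - (1 - eta) ^+ t) * (gg_peak a b * E U - gg_peak a b * (E U - E V) * rho).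
Proof.
move=> /andP[r0 r1] /andP[e0 e1].
set K := gg_peak a b; set D := K * E U - K * (E U - E V) * rho.
have K0 : 0 < K by exact: gg_peak_gt0.
(* The start stays general: after the first sample the recursion restarts from theta_1. *)
elim: t theta0 => [|t IH] theta0.
  by rewrite expr0 subrr mul0r addr0 mulr1; exact: loss_lipschitz.
set q := (1 - eta) ^+ t in IH *.
have q0 : 0 < q by rewrite exprn_gt0// subr_gt0.
(* Inserting the bound on |theta_1 - theta_star| into the induction hypothesis leaves [c], free of
   the sample, and [k] times the convex combination of distances. *)
pose c := L ts + (K * ((1 - eta) * `|theta0 - ts|) * q + (1 - q) * D).
pose k := K * eta * q.
have step : exp_loss mu1 mu2 a b rho eta t.+1 theta0 <=
    E (fun x y => c + (k * (1 - rho) * U x y + k * rho * V x y)).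
  apply: EG_le => [x y|x y|y]; first exact: exp_loss_ge0.
    have := IH (theta0 - eta * (theta0 + x - (rho * fsign ts x + (1 - rho) * y))).
    rewrite lerBlDl => /le_trans; apply.
    set w := _ - ts.
    have wE : w = (1 - eta) * (theta0 - ts) +
        (- eta) * ((1 - rho) * (x - y + ts) + rho * (x - fsign ts x + ts)).
      by rewrite /w; ring.
    have wle : `|w| <= (1 - eta) * `|theta0 - ts| +
        eta * ((1 - rho) * U x y + rho * V x y).
      rewrite wE (le_trans (ler_normD _ _))// !normrM normrN.
      rewrite (gtr0_norm e0) gtr0_norm ?subr_gt0// lerD2l ler_pM2l//.
      rewrite (le_trans (ler_normD _ _))// !normrM.
      by rewrite (ger0_norm r0) ger0_norm ?subr_ge0.
    have := ler_wpM2r (ltW q0) (ler_wpM2l (ltW K0) wle).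
    rewrite /c /k; lra.
  apply: linear_growthD; first exact: linear_growth_cst.
  apply: linear_growthD; apply: linear_growthM.
    exact: linear_growth_dist.
  exact: linear_growth_dist_fsign.
rewrite lerBlDl (le_trans step)// EG_lin; last 2 first.
- exact: linear_growth_dist.
- exact: linear_growth_dist_fsign.
(* Equality holds here: the averaged distances contribute [eta * q * D], and (1 - q) + eta q = 1 -
   (1 - eta) q. *)
rewrite exprS -/q /c /k /D; move: (E U) (E V) (L ts) => u v l.
by rewrite le_eqVlt; apply/orP; left; apply/eqP; ring.
Qed.

End mixture.

Theorem theorem2 (R : realType) (mu1 mu2 alpha0 beta0 : R) :
  mu1 < mu2 -> 0 < alpha0 -> 0 < beta0 ->
  let ts := theta_star mu1 mu2 in
  let L := loss mu1 mu2 alpha0 beta0 in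
  let eps0 := EG mu1 mu2 alpha0 beta0 (fun x y => `|x - y + ts|)
            - EG mu1 mu2 alpha0 beta0 (fun x _ => `|x - fsign ts x + ts|) in
  exists C1 : R, 0 < C1 /\
    (* (i) *)
    (forall theta : R, L theta - L ts <= C1 * `|theta - ts|) /\
    (* (ii) *)
    0 < eps0 /\
    (* (iii) *)
    (forall (rho theta0 eta : R) (t : nat),
       0 <= rho <= 1 -> 0 < eta < 1 ->
       let C2 := C1 * `|theta0 - ts| in
       let C3 := C1 * EG mu1 mu2 alpha0 beta0 (fun x y => `|x - y + ts|) in
       let C4 := C1 * eps0 in
       0 < C4 /\
       exp_loss mu1 mu2 alpha0 beta0 rho eta t theta0 - L ts
         <= C2 * (1 - eta) ^+ t + (1 - (1 - eta) ^+ t) * (C3 - C4 * rho)).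
Proof.
move=> _ a0 b0 ts L eps0.
have p0 := gg_peak_gt0 alpha0 beta0 a0 b0.
have e0 : 0 < eps0 by exact: EG_dist_gt.
exists (gg_peak alpha0 beta0); split => //; split; first by move=> theta; exact: loss_lipschitz.
split => // rho theta0 eta t r01 e01; split; first exact: mulr_gt0.
exact: exp_loss_le.
Qed.
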